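(* Consider many-sorted first-order terms with a counter sort $C$ (constructors $Z:C$, $S:C\to C$), a generator sort $Y$ with no function symbols, and a carrier sort $T$, with an active-site symbol $F:T\times Y\times C\to T$ and a frame constructor $G:Y\times T\to T$. Let $\rho(x,y,n)$ be a right-hand-side term of sort $T$ whose variables are among $x:T$, $y:Y$, $n:C$ (so that $F(x,y,S(n))\to\rho(x,y,n)$ is a step rule). If $\rho(x,y,n)$ contains both an occurrence of a subterm headed by $G$ and an occurrence of a subterm headed by $F$, then $\rho(x,y,n)$ contains at least two syntactically distinct occurrences (at distinct positions) of the generator variable $y$: one as the first argument of a $G$-headed subterm and one as the second (generator) argument of an $F$-headed subterm. *)

(* Defs.v *)
From Stdlib Require List.
From mathcomp Require Import all_boot.

Set Implicit Arguments.
Unset Strict Implicit.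
Unset Printing Implicit Defensive.

Record signature (sort : Type) := Signature {
  symbol : Type;
  dom : symbol -> seq sort;
  cod : symbol -> sort
}.

Section Terms.
Variables (sort : Type) (Sg : signature sort).
Variables (X : Type) (var_sort : X -> sort).

Inductive term :=
| Var of X
| App of symbol Sg & seq term.

Inductive has_sort : term -> sort -> Prop :=
| has_sort_Var v : has_sort (Var v) (var_sort v)
| has_sort_App f ts :
    List.Forall2 has_sort ts (dom f) -> has_sort (App f ts) (cod f).

(* Positions are sequences of argument indices, counted from 0. *)
Fixpoint subterm_at (t : term) (p : seq nat) : option term :=
  match p, t with
  | [::], _ => Some t
  | i :: p', App _ ts => obind (subterm_at^~ p') (onth ts i)
  | _ :: _, Var _ => None
  end.

Definition headed_at (f : symbol Sg) (t : term) (p : seq nat) : Prop :=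
  exists ts, subterm_at t p = Some (App f ts).

Definition occurs_at (v : X) (t : term) (p : seq nat) : Prop :=
  subterm_at t p = Some (Var v).

Definition occurs_as_arg (v : X) (f : symbol Sg) (i : nat)
    (t : term) (p : seq nat) : Prop :=
  occurs_at v t p /\ exists2 p0, headed_at f t p0 & p = rcons p0 i.

End Terms.

Arguments Var {sort Sg X}.

Inductive step_sort := sC | sY | sT.

(* The signature may contain further symbols, subject only to the absence of
   symbols of result sort Y, so that every term of sort Y is a variable. *)
Record step_signature := StepSignature {
  step_sig :> signature step_sort;
  symZ : symbol step_sig;
  symS : symbol step_sig;
  symF : symbol step_sig;
  symG : symbol step_sig;
  symZ_dom : dom symZ = [::];
  symZ_cod : cod symZ = sC;
  symS_dom : dom symS = [:: sC];
  symS_cod : cod symS = sC;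
  symF_dom : dom symF = [:: sT; sY; sC];
  symF_cod : cod symF = sT;
  symG_dom : dom symG = [:: sY; sT];
  symG_cod : cod symG = sT;
  no_symbol_sY : forall f : symbol step_sig, cod f <> sY
}.

Inductive rule_var := vx | vy | vn.

Definition rule_var_sort (v : rule_var) : step_sort :=
  match v with vx => sT | vy => sY | vn => sC end.

(* Main.v *)
(** Subterms of a well-sorted term are well-sorted, and a term whose sort is not
    the result sort of any symbol can only be a variable of that sort; for the
    sort [Y] this variable is [y].  So [y] is argument 0 of every [G]-headed
    subterm of [rho], and argument 1 of every [F]-headed one.  The two positions
    differ because their last indices do. *)
Require Import Defs.
From Stdlib Require List.
From mathcomp Require Import all_boot.

Set Implicit Arguments.
Unset Strict Implicit.
Unset Printing Implicit Defensive.

Lemma Forall2_onthl (A B : Type) (P : A -> B -> Prop) (s : seq A) (r : seq B)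
    (i : nat) (a : A) :
  List.Forall2 P s r -> onth s i = Some a ->
  exists2 b, onth r i = Some b & P a b.
Proof.
move=> sr; elim: sr i => [|a' b s' r' Pab _ IH] [|i] //=; last exact: IH.
by case=> <-; exists b.
Qed.

Lemma Forall2_onthr (A B : Type) (P : A -> B -> Prop) (s : seq A) (r : seq B)
    (i : nat) (b : B) :
  List.Forall2 P s r -> onth r i = Some b ->
  exists2 a, onth s i = Some a & P a b.
Proof. by move/List.Forall2_flip; apply: Forall2_onthl. Qed.

Section SortedTerms.
Variables (sort : Type) (Sg : signature sort).
Variables (X : Type) (var_sort : X -> sort).
Implicit Types (t u : term Sg X) (f : symbol Sg) (s r : sort) (p q : seq nat).

Lemma has_sort_inv t s :
  has_sort var_sort t s ->
  match t with
  | Var v => var_sort v = s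
  | App f ts => List.Forall2 (has_sort var_sort) ts (dom f) /\ cod f = s
  end.
Proof. by case. Qed.

Lemma subterm_at_cat t p q :
  subterm_at t (p ++ q) = obind (fun u => subterm_at u q) (subterm_at t p).
Proof.
elim: p t => [|i p IH] [v|f ts] //=.
by case: (onth ts i).
Qed.

Lemma has_sort_subterm_at t s p u :
  has_sort var_sort t s -> subterm_at t p = Some u ->
  exists r, has_sort var_sort u r.
Proof.
elim: p t s => [|i p IH] t s t_s /=; first by case=> <-; exists s.
case: t t_s => // f ts /has_sort_inv[ts_dom _].
case ts_i: (onth ts i) => [t'|] //= t'_p.
have [r _ t'_r] := Forall2_onthl ts_dom ts_i.
exact: IH t'_r t'_p.
Qed.

Lemma has_sort_arg_at t s f p i r :
  has_sort var_sort t s -> headed_at f t p -> onth (dom f) i = Some r ->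
  exists2 u, subterm_at t (rcons p i) = Some u & has_sort var_sort u r.
Proof.
move=> t_s [ts t_p] f_i.
have [_ /has_sort_inv[ts_dom _]] := has_sort_subterm_at t_s t_p.
have [u ts_i u_r] := Forall2_onthr ts_dom f_i.
by exists u; rewrite // -cats1 subterm_at_cat t_p /= ts_i.
Qed.

Section ConstructorFreeSort.
Variable r : sort.
Hypothesis cod_neq : forall f, cod f <> r.

Lemma constructor_free_sort_Var t :
  has_sort var_sort t r -> exists2 v, t = Var v & var_sort v = r.
Proof.
case: t => [v|f ts] /has_sort_inv; first by exists v.
by case=> _ /cod_neq.
Qed.

Lemma constructor_free_sort_occurs_as_arg t s f p i :
  has_sort var_sort t s -> headed_at f t p -> onth (dom f) i = Some r ->
  exists2 v, occurs_as_arg v f i t (rcons p i) & var_sort v = r.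
Proof.
move=> t_s f_p f_i.
have [u t_pi /constructor_free_sort_Var[v u_v v_r]] :=
  has_sort_arg_at t_s f_p f_i.
by exists v => //; split; [rewrite /occurs_at -u_v | exists p].
Qed.

End ConstructorFreeSort.

End SortedTerms.

Lemma occurs_as_arg_vy (Sg : step_signature) (t : term Sg rule_var)
    (s : step_sort) (f : symbol Sg) (p : seq nat) (i : nat) :
  has_sort rule_var_sort t s -> headed_at f t p -> onth (dom f) i = Some sY ->
  occurs_as_arg vy f i t (rcons p i).
Proof.
move=> t_s f_p f_i.
have cod_neq_sY := @no_symbol_sY Sg.
by have [[]] := constructor_free_sort_occurs_as_arg cod_neq_sY t_s f_p f_i.
Qed.

Theorem theorem3p30 (Sg : step_signature) (rho : term Sg rule_var)
    (rho_sort : has_sort rule_var_sort rho sT)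
    (has_G : exists p, headed_at (symG Sg) rho p)
    (has_F : exists p, headed_at (symF Sg) rho p) :
  exists p q : seq nat,
    [/\ p <> q,
        occurs_as_arg vy (symG Sg) 0 rho p
      & occurs_as_arg vy (symF Sg) 1 rho q].
Proof.
have [p G_p] := has_G; have [q F_q] := has_F.
exists (rcons p 0), (rcons q 1); split.
- by case/rcons_inj.
- by apply: occurs_as_arg_vy rho_sort G_p _; rewrite symG_dom.
- by apply: occurs_as_arg_vy rho_sort F_q _; rewrite symF_dom.
Qed.
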